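(* Let $r$ be a positive integer and $T=r^{5r^2}$. Then there exist a finite set $\mathcal{L}$ of lines and a finite point set $\mathcal{P}$ in $\mathbb{R}^2$ such that (i) every line of $\mathcal{L}$ contains at least $r$ points of $\mathcal{P}$; (ii) every point of $\mathcal{P}$ shares a line of $\mathcal{L}$ with at most $T$ other points of $\mathcal{P}$; (iii) $\mathcal{P}$ cannot be decomposed into two covering systems, i.e., there is no partition $\mathcal{P}=\mathcal{P}_1\cup\mathcal{P}_2$ such that every line of $\mathcal{L}$ contains a point of $\mathcal{P}_1$ and a point of $\mathcal{P}_2$. *)

(* Defs.v *)
From Stdlib Require Import Reals List.
Import ListNotations.
Open Scope R_scope.

Definition point : Type := (R * R)%type.

Record line : Type := Line {
  la : R; lb : R; lc : R;
  line_nondeg : la <> 0 \/ lb <> 0 }.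

Definition on_line (l : line) (p : point) : Prop :=
  la l * fst p + lb l * snd p = lc l.

Definition line_has_at_least (P : list point) (l : line) (r : nat) : Prop :=
  exists s : list point, NoDup s /\ (r <= length s)%nat /\
    forall q, In q s -> In q P /\ on_line l q.

Definition shares_line_with_at_most (L : list line) (P : list point)
  (p : point) (T : nat) : Prop :=
  forall s : list point, NoDup s ->
    (forall q, In q s -> In q P /\ q <> p /\
       exists l, In l L /\ on_line l p /\ on_line l q) ->
    (length s <= T)%nat.

(* P = P1 ∪ P2 (P1 given by a predicate, P2 its complement in P)
   with every line of L meeting both P1 and P2 *)
Definition decomposable_two_covers (L : list line) (P : list point) : Prop :=
  exists P1 : point -> Prop,
    forall l, In l L ->
      (exists p, In p P /\ on_line l p /\ P1 p) /\
      (exists p, In p P /\ on_line l p /\ ~ P1 p).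

(* Main.v *)
(** The points are taken from the grid [k]^d, which is mapped to the plane by
    x |-> (sum x_j, sum x_j B^j); uniqueness of base-B digits shows that exactly the
    axis-parallel lines of direction j become the lines of slope B^j.

    Choose about k^(d-1)/E grid points at random and delete one from each collinear
    (r+1)-tuple; few are lost, and every line keeps at most r points. The lines of the
    configuration are those with exactly r points, so a decomposition splits the
    points into two sets without r collinear points. By the container method, each such
    set Q lies in F + C(F), where F is a small subset of Q and C(F), which depends on F only,
    has fewer than a quarter of the grid points. Two such containers cover about half of
    the grid, and with positive probability no union of this kind, built from few of the
    random points, catches 19/20 of them.

    The containers come from the following algorithm: while some available point y
    has large degree in the lines that need j + 1 further points (least j first), query
    whether y is in Q; if not, discard y, otherwise put y in F and lower the need of these
    lines. Degrees stay bounded because two points share at most one line, which bounds F,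
    and convexity shows that few points are available at the end. *)

Require Import Defs.
From Stdlib Require Import Reals List Lra FinFun ClassicalEpsilon.
From mathcomp Require all_boot zify.

Module Combinatorics.

Import all_boot zify.
Set Implicit Arguments.
Unset Strict Implicit.
Unset Printing Implicit Defensive.
Local Open Scope nat_scope.
Delimit Scope R_scope with Re.

(** * Incidence counts and the effect of one query *)

Section Container.

Variables (S Ln : finType) (inc : S -> Ln -> bool) (k d r q : nat).

Definition trace (C : {set S}) (l : Ln) : nat := #|[set x in C | inc x l]|.

(* rem l = j means that chosen has at least r - 1 - j points on l, so that j + 1 further
   points would complete r collinear ones; sel j counts the selections made at level j. *)
Record state := State {
  avail : {set S}; chosen : {set S}; rem : Ln -> nat; sel : nat -> nat }.

(** For [y] in [C], the degree of [y] in the hypergraph of level [j], whose edges are the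
    [j.+1]-subsets of [C] on a line with [rem l = j]; [energy] counts these edges. *)
Definition deg (C : {set S}) (rem : Ln -> nat) (j : nat) (y : S) : nat :=
  \sum_(l | inc y l && (rem l == j)) 'C((trace C l).-1, j).

Definition energy (C : {set S}) (rem : Ln -> nat) (j : nat) : nat :=
  \sum_(l | rem l == j) 'C(trace C l, j.+1).

(** [cap j] is the degree bound kept at level [j], and [thr j] the degree from which a point is
    queried. A selection at level [j.+1] creates at least [q * cap j] edges of level [j], which is
    [q] times what the removal of one point destroys. *)
Fixpoint cap (j : nat) : nat :=
  if j is i.+1 then q * cap i + k ^ j else 1.

Definition thr (j : nat) : nat := if j is i.+1 then q * cap i else 1.

Definition advance (rem : Ln -> nat) (y : S) (j : nat) (l : Ln) : nat :=
  if inc y l && (rem l == j) then j.-1 else rem l.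

Hypothesis card_line : forall l, #|[set x | inc x l]| = k.
Hypothesis two_points : forall x y l l', x != y ->
  inc x l -> inc y l -> inc x l' -> inc y l' -> l = l'.

Lemma trace_le C l : trace C l <= k.
Proof.
by rewrite -(card_line l) subset_leq_card //; apply/subsetP=> x; rewrite !inE => /andP[].
Qed.

Lemma traceS (C D : {set S}) l : C \subset D -> trace C l <= trace D l.
Proof.
move=> sCD; rewrite subset_leq_card //; apply/subsetP=> x; rewrite !inE => /andP[xC ->].
by rewrite (subsetP sCD).
Qed.

Lemma trace_D1 (C : {set S}) y l : y \in C ->
  trace C l = (inc y l) + trace (C :\ y) l.
Proof.
move=> yC; rewrite /trace.
rewrite (cardsD1 y) !inE yC /=; congr (_ + _); apply: eq_card => x.
by rewrite !inE andbA.
Qed.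

Lemma energy_drop (C : {set S}) rm j y : y \in C ->
  energy C rm j = energy (C :\ y) rm j + deg C rm j y.
Proof.
move=> yC; rewrite /energy /deg.
under [X in _ + X]eq_bigl => l do rewrite andbC.
rewrite [X in _ + X]big_mkcondr -big_split /=; apply: eq_bigr => l _.
rewrite (trace_D1 l yC); case: (inc y l); rewrite ?addn0 //=.
Qed.

Lemma deg_mono (C D : {set S}) rm j y : D \subset C -> deg D rm j y <= deg C rm j y.
Proof.
move=> sDC; apply: leq_sum => l _; apply: leq_bin2l.
by have := traceS l sDC; case: (trace D l) (trace C l) => [|a] [|b].
Qed.

(** Lines of level [j] through [y] move to level [j.-1], where their edges are the old edges at [y]
    without [y]. For the loss at level [j], use ['C(n, j.+1) <= n * 'C(n.-1, j)] with [n <= k]. *)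
Lemma energy_select (C : {set S}) rm j y : y \in C -> 0 < j ->
  [/\ energy (C :\ y) rm j.-1 + deg C rm j y <= energy (C :\ y) (advance rm y j) j.-1,
      energy C rm j <= energy (C :\ y) (advance rm y j) j + k * deg C rm j y
    & forall i, i != j -> i != j.-1 ->
      energy (C :\ y) (advance rm y j) i = energy (C :\ y) rm i].
Proof.
case: j => // j yC _; split => /=.
- rewrite /energy /deg /advance /=.
  rewrite big_mkcond [X in _ + X]big_mkcond [X in _ <= X]big_mkcond -big_split /=.
  apply: leq_sum => l _; rewrite (trace_D1 l yC).
  case: (inc y l) => /=; last by rewrite addn0.
  rewrite ?add1n /=; case: (eqVneq (rm l) j.+1) => [->|_]; last by rewrite addn0.
  by rewrite eqxx (_ : (j.+1 == j) = false) //; lia.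
- rewrite /energy /deg /advance big_distrr /=.
  rewrite big_mkcond [X in _ <= X + _]big_mkcond [X in _ <= _ + X]big_mkcond -big_split /=.
  apply: leq_sum => l _; rewrite (trace_D1 l yC).
  case I: (inc y l) => /=; last by rewrite addn0.
  case: (eqVneq (rm l) j.+1) => [e|_] //; rewrite (_ : (j == j.+1) = false) ?add0n; last lia.
  have := trace_le C l; rewrite (trace_D1 l yC) I add1n /= => H.
  apply: (@leq_trans ((trace (C :\ y) l).+1 * 'C(trace (C :\ y) l, j.+1))).
    by rewrite (mul_bin_diag (trace (C :\ y) l).+1 j.+1) leq_pmull.
  by rewrite leq_mul2r H orbT.
- move=> i ni nj; rewrite /energy /advance; apply: eq_bigl => l.
  case: ifP => // /andP[_ /eqP e]; lia.
Qed.

Lemma deg_select_other (C : {set S}) rm j y i z : i != j.-1 ->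
  deg (C :\ y) (advance rm y j) i z <= deg C rm i z.
Proof.
move=> ni; apply: leq_trans (deg_mono rm i z (subsetDl C [set y])).
rewrite /deg big_mkcond [X in _ <= X]big_mkcond /=; apply: leq_sum => l _.
rewrite /advance; case: ifP => //; case: (inc z l) => //=.
case: (inc y l && (rm l == j)) => [|->] //.
by rewrite eq_sym (negbTE ni).
Qed.

(* Two points share at most one line, so a selection can raise the degree of another
   point by the contribution of one line only. *)
Lemma deg_select (C : {set S}) rm j y z : z \in C :\ y ->
  deg (C :\ y) (advance rm y j) j.-1 z <= deg C rm j.-1 z + k ^ j.-1.
Proof.
rewrite !inE => /andP[nzy zC].
apply: leq_trans (leq_add (deg_mono rm j.-1 z (subsetDl C [set y])) (leqnn _)).
have B l : 'C((trace (C :\ y) l).-1, j.-1) <= k ^ j.-1.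
  apply: leq_trans (leq_bin2l _ (_ : _ <= k)) _; first by have := trace_le (C :\ y) l; lia.
  apply: leq_trans (_ : k ^_ j.-1 <= _).
    by rewrite -bin_ffact leq_pmulr // fact_gt0.
  rewrite ffact_prod; apply: leq_trans (_ : \prod_(i < j.-1) k <= _).
    by apply: leq_prod => i _; lia.
  by rewrite prod_nat_const card_ord.
rewrite /deg.
case: (pickP [pred l | inc z l && inc y l]) => [l0 /= /andP[z0 y0]|none].
  rewrite big_mkcond (bigD1 l0) //= [X in _ <= X + _]big_mkcond [X in _ <= X + _](bigD1 l0) //=.
  rewrite z0 /= addnAC; apply: leq_add.
    by apply: leq_trans (leq_addl _ _); case: ifP.
  apply: leq_sum => l nl; rewrite /advance.
  case zl: (inc z l) => //=; case yl: (inc y l) => //=.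
  by case/eqP: nl; apply: (two_points nzy).
apply: leq_trans (leq_addr _ _).
rewrite big_mkcond [X in _ <= X]big_mkcond; apply: leq_sum => l _ /=.
by rewrite /advance; have /= := none l; case: (inc z l) => //= ->.
Qed.


(** * The query algorithm and its invariant *)

(** The fourth clause balances edges of level [j]: those created by selections at level [j.+1] are
    still present, or were lost with a removed point, or with lines advanced by a selection at level
    [j]. *)
Definition valid (s : state) : Prop :=
  [/\ [disjoint chosen s & avail s],
      (forall l, rem s l < r /\ r <= (trace (chosen s) l + rem s l).+1),
      (forall j y, j.+1 < r -> y \in avail s ->
        deg (avail s) (rem s) j y <= cap j),
      (forall j, j.+1 < r -> sel s j.+1 * thr j.+1 <=
        energy (avail s) (rem s) j + #|~: avail s| * cap j + sel s j * k * cap j)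
    & sel s 0 = 0 /\ #|chosen s| <= \sum_(1 <= j < r) sel s j].

Definition final (s : state) : Prop :=
  forall j y, j < r -> y \in avail s -> deg (avail s) (rem s) j y < thr j.

Definition drop (s : state) (y : S) : state :=
  State (avail s :\ y) (chosen s) (rem s) (sel s).

Definition select (s : state) (y : S) (j : nat) : state :=
  State (avail s :\ y) (y |: chosen s) (advance (rem s) y j)
    (fun i => sel s i + (i == j)).

Lemma cardsCD1 (C : {set S}) y : y \in C -> #|~: (C :\ y)| = #|~: C|.+1.
Proof.
move=> yC; have := cardsC C; have := cardsC (C :\ y); have := cardsD1 y C.
by rewrite yC; lia.
Qed.

Lemma valid_drop s y : valid s -> y \in avail s -> valid (drop s y).
Proof.
case=> [dis rl dg en sl] yC; split => //=.
- by apply: disjointWr dis; apply: subsetDl.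
- move=> j z jr; rewrite !inE => /andP[_ zC].
  by apply: leq_trans (deg_mono _ _ _ (subsetDl _ _)) (dg j z jr zC).
move=> j jr; rewrite (cardsCD1 yC).
have /= := en j jr; rewrite (energy_drop _ _ yC) => H.
have := dg j y jr yC; rewrite mulSn; lia.
Qed.

Lemma thr_cap j : thr j + k ^ j <= (cap j).+1.
Proof. by case: j => //= j; lia. Qed.

(** Taking the least level first matters: by [low] the degrees one level below are under [thr], so
    the gain from [deg_select] keeps them within [cap]. *)
Lemma valid_select s y j : valid s -> y \in avail s -> 0 < j < r ->
  thr j <= deg (avail s) (rem s) j y ->
  (forall i z, i < j -> z \in avail s -> deg (avail s) (rem s) i z < thr i) ->
  valid (select s y j).
Proof.
case: s => C F rm sl; case=> /= [dis rl dg en [s0 sF]] yC.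
case: j => // j /andP[_ jr] tj low.
have yF : y \notin F by rewrite (disjointFl dis).
have [/= e1 e2 e3] := energy_select rm yC (ltn0Sn j).
have trF l : trace (y |: F) l = inc y l + trace F l.
  by rewrite (@trace_D1 _ y) ?setU11 // setU1K.
split => /=.
- rewrite disjoint_subset; apply/subsetP => x; rewrite !inE.
  by case: eqP => //= _ xF; rewrite (disjointFr dis xF).
- move=> l; have [r1 r2] := rl l; rewrite /advance trF.
  by case: (inc y l) => //=; case: eqP => // e; split; lia.
- move=> i z ir zC; have zC' : z \in C by move: zC; rewrite inE => /andP[].
  case: (eqVneq i j) => [->|ni]; last first.
    by apply: leq_trans (deg_select_other C rm y z (_ : i != j.+1.-1)) _ => //; apply: dg.
  apply: leq_trans (deg_select rm j.+1 zC) _.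
  have := low j z (leqnn _) zC'; have := thr_cap j; rewrite /=; lia.
- move=> i ir; rewrite (cardsCD1 yC).
  have /= := en i ir; rewrite (energy_drop rm i yC) => H.
  have D := dg i y ir yC.
  (* Level [j] gains the edges at [y], which pay for the new selection; level [j.+1] loses the
     advanced lines, at most [k * cap j.+1]; every other level only loses [y]. *)
  case: (eqVneq i j) => [ei|ni].
    subst i; rewrite eqxx.
    have -> : (j == j.+1) = false by lia.
    rewrite /= in tj; rewrite mulnDl mul1n mulSn addn0; lia.
  have -> : (i.+1 == j.+1) = false by lia.
  rewrite addn0 mulSn; case: (eqVneq i j.+1) => [ei|nj]; last first.
    by rewrite e3 // addn0; lia.
  subst i; rewrite (energy_drop rm j.+1 yC) in e2.
  have := leq_mul (leqnn k) D; rewrite [_ + true]addn1 mulSn mulnDl; lia.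
- split; first by rewrite s0.
  rewrite cardsU1 yF big_split /= addnC; apply: leq_add => //.
  rewrite (bigD1_seq j.+1) ?iota_uniq //= ?eqxx //.
  by rewrite mem_index_iota.
Qed.

Definition line_free (Q : {set S}) : Prop := forall l, trace Q l < r.

(* The final state is a function of its set of chosen points alone: a queried point is
   in Q if and only if it ends up chosen. *)
Lemma run s : valid s -> exists f : {set S} -> state, forall Q : {set S},
  line_free Q -> chosen s \subset Q -> Q \subset chosen s :|: avail s ->
  exists s', [/\ valid s', final s', chosen s \subset chosen s',
    chosen s' \subset Q & Q \subset chosen s' :|: avail s' /\ f (chosen s') = s'].
Proof.
have [n] := ubnP #|avail s|; elim: n s => // n IH s ns vs.
pose query j := (j < r) && [exists y in avail s, thr j <= deg (avail s) (rem s) j y].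
have [/existsP qr|noq] := boolP [exists j : 'I_r, query j]; last first.
  exists (fun=> s) => Q _ cQ Qc; exists s; split => // j y jr yC.
  rewrite ltnNge; apply: contra noq => H; apply/existsP; exists (Ordinal jr).
  by rewrite /query jr; apply/existsP; exists y; rewrite yC.
have {qr}exq : exists j, query j by case: qr => j qj; exists j.
case: (ex_minnP exq) => j /andP[jr /existsP[y /andP[yC tj]]] minj.
have low i z : i < j -> z \in avail s -> deg (avail s) (rem s) i z < thr i.
  move=> ij zC; rewrite ltnNge; apply/negP => H.
  suff /minj : query i by lia.
  by rewrite /query (ltn_trans ij jr); apply/existsP; exists z; rewrite zC.
have smaller : #|avail s :\ y| < n by have := cardsD1 y (avail s); rewrite yC; lia.
have [f0 H0] := IH (drop s y) smaller (valid_drop vs yC).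
have no Q : line_free Q -> chosen s \subset Q -> Q \subset chosen s :|: avail s ->
    y \notin Q -> exists s', [/\ valid s', final s', chosen s \subset chosen s',
    chosen s' \subset Q & Q \subset chosen s' :|: avail s' /\ f0 (chosen s') = s'].
  move=> fQ cQ Qc yQ; apply: H0 => //=; apply/subsetP => x xQ.
  have := subsetP Qc x xQ; rewrite !inE; case/orP => [->//|->].
  by rewrite andbT orbC; case: eqP xQ yQ => [->->|].
(* At level 0 some line through [y] already has [r.-1] chosen points, so a line-free [Q] cannot
   contain [y] and only one answer is possible. *)
case: (posnP j) => [j0|jgt].
  exists f0 => Q fQ cQ Qc; apply: no => //; apply/negP => yQ.
  case: vs => dis rl _ _ _; move: tj; rewrite j0 /= /deg.
  case: (pickP (fun l => inc y l && (rem s l == 0))) => [l /andP[yl /eqP r0] _|none]; last first.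
    by rewrite big_pred0.
  have [_] := rl l; rewrite r0 addn0 => rF.
  have := fQ l; rewrite (trace_D1 l yQ) yl.
  suff : trace (chosen s) l <= trace (Q :\ y) l by lia.
  by apply: traceS; rewrite subsetD1 cQ (disjointFl dis).
have [f1 H1] := IH (select s y j) smaller (valid_select vs yC (introT andP (conj jgt jr)) tj low).
exists (fun F : {set S} => if y \in F then f1 F else f0 F) => Q fQ cQ Qc.
have [yQ|yQ] := boolP (y \in Q); last first.
  have [s' [v' fi' c' cQ' [Qc' e']]] := no Q fQ cQ Qc yQ.
  exists s'; split => //; split => //; case: ifP => // yc.
  by rewrite (subsetP cQ' _ yc) in yQ.
have [||s' [v' fi' c' cQ' [Qc' e']]] := H1 Q fQ.
- by rewrite subUset sub1set yQ.
- apply/subsetP => x /(subsetP Qc); rewrite !inE.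
  by case: eqP => //= _; case: (x \in chosen s).
exists s'; split => //; first by apply: subset_trans c'; apply: subsetUr.
by split => //; rewrite (subsetP c' y) // setU11.
Qed.


(** * Sizes of fingerprints and containers *)

Hypothesis card_pencil : forall x, #|[set l | inc x l]| = d.

Lemma sum_trace (C : {set S}) (h : Ln -> nat) :
  \sum_l trace C l * h l = \sum_(y in C) \sum_(l | inc y l) h l.
Proof.
rewrite [RHS](exchange_big_dep predT) //=; apply: eq_bigr => l _.
by rewrite sum_nat_const /trace cardsE.
Qed.

Lemma energy_le C rm j : energy C rm j <= \sum_(y in C) deg C rm j y.
Proof.
rewrite /energy /deg big_mkcond /=.
under [X in _ <= X]eq_bigr => y _ do rewrite big_mkcondr /=.
rewrite -sum_trace; apply: leq_sum => l _; case: ifP => // _.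
by rewrite mul_bin_diag leq_pmull.
Qed.

(** Cancelling [cap j] in the edge balance gives [sel j.+1 * q <= #|S| + sel j * k], whence
    [sel j * (q - k) <= #|S|] at each of the [r.-1] levels. *)
Lemma valid_chosen s : valid s -> k <= q ->
  #|chosen s| * (q - k) <= r.-1 * #|S|.
Proof.
case=> [_ _ dg en [s0 sF]] kq.
have cap0 j : 0 < q -> 0 < cap j.
  by move=> q0; elim: j => //= j IH; rewrite addn_gt0 muln_gt0 q0 IH.
have [->|qgt] := posnP q; first by rewrite sub0n muln0.
have step j : j.+1 < r -> sel s j.+1 * q <= #|S| + sel s j * k.
  move=> jr; rewrite -(leq_pmul2r (cap0 j qgt)) mulnDl -mulnA.
  apply: leq_trans (en j jr) _; rewrite leq_add2r.
  apply: leq_trans (_ : #|avail s| * cap j + #|~: avail s| * cap j <= _).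
    rewrite leq_add2r; apply: leq_trans (energy_le _ _ _) _.
    by rewrite -sum_nat_const; apply: leq_sum => y yC; apply: dg.
  by rewrite -mulnDl cardsC.
have bnd j : j < r -> sel s j * (q - k) <= #|S|.
  elim: j => [|j IH] jr; first by rewrite s0.
  have [eq|kltq] := leqP q k; first by rewrite (_ : q - k = 0) ?muln0 //; lia.
  rewrite -(leq_pmul2r qgt) mulnAC; have := step j jr; have := IH (ltnW jr).
  move=> h1 h2; apply: leq_trans (leq_mul h2 (leqnn (q - k))) _.
  rewrite mulnDl (mulnAC (sel s j)); have := leq_mul h1 (leqnn k).
  have -> : #|S| * q = #|S| * (q - k) + #|S| * k by rewrite -mulnDr subnK.
  lia.
apply: leq_trans (leq_mul sF (leqnn _)) _.
rewrite big_distrl /=; apply: leq_trans (_ : \sum_(1 <= j < r) #|S| <= _).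
  by rewrite big_nat_cond [X in _ <= X]big_nat_cond; apply: leq_sum => j /andP[/andP[_ /bnd]].
by rewrite sum_nat_const_nat subn1.
Qed.

(** Convexity of [c |-> 'C(c, s.+1)]: it lies above the line through its value at [a] with slope
    ['C(a, s)]. Terms are arranged to avoid subtraction. *)
Lemma bin_tangent a c s :
  'C(a, s.+1) + c * 'C(a, s) <= 'C(c, s.+1) + a * 'C(a, s).
Proof.
have [/subnK <-|/ltnW/subnK <-] := leqP a c.
  elim: (c - a) => [|i IH]; first by rewrite add0n.
  rewrite addSn mulSn binS.
  have := leq_bin2l s (leq_addl i a); lia.
have H i : 'C(i + c, s.+1) <= 'C(c, s.+1) + i * 'C(i + c, s).
  elim: i => [|i IH]; first by rewrite add0n mul0n addn0.
  rewrite addSn binS mulSn.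
  have h : 'C(i + c, s) <= 'C((i + c).+1, s) by apply: leq_bin2l.
  have := leq_mul (leqnn i) h; lia.
have := H (a - c); rewrite mulnDl; lia.
Qed.

Lemma double_count : #|Ln| * k = d * #|S|.
Proof.
have := sum_trace [set: S] (fun=> 1).
have -> : \sum_l trace [set: S] l * 1 = #|Ln| * k.
  rewrite -sum_nat_const; apply: eq_bigr => l _; rewrite muln1 -(card_line l).
  by apply: eq_card => x; rewrite !inE.
move=> ->; rewrite mulnC -cardsT -sum_nat_const; apply: eq_bigr => y _.
by rewrite sum1dep_card card_pencil.
Qed.

(** A quarter of all points meets a line in at least [a] points on average; summing [bin_tangent]
    over the lines gives the bound. *)
Lemma jensen_trace (C : {set S}) a : 0 < r -> k = 4 * a -> #|S| <= 4 * #|C| ->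
  #|C| * (d * 'C(a.-1, r.-1)) <= \sum_l trace C l * 'C((trace C l).-1, r.-1).
Proof.
case: r => //= s _ ka SC.
have tot : \sum_l trace C l = d * #|C|.
  under eq_bigr => l _ do rewrite -[trace C l]muln1.
  rewrite sum_trace mulnC -sum_nat_const; apply: eq_bigr => y _.
  by rewrite sum1dep_card card_pencil.
have avg : a * #|Ln| <= \sum_l trace C l.
  rewrite tot -(leq_pmul2l (ltn0Sn 3)) mulnA -ka mulnC double_count.
  by rewrite mulnCA leq_mul2l SC orbT.
under eq_bigr => l _ do rewrite mul_bin_diag.
have T : #|Ln| * 'C(a, s.+1) + (\sum_l trace C l) * 'C(a, s) <=
         \sum_l 'C(trace C l, s.+1) + #|Ln| * (a * 'C(a, s)).
  rewrite -!sum_nat_const big_distrl -!big_split /=; apply: leq_sum => l _.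
  exact: bin_tangent.
rewrite -big_distrr /= mulnA (mulnC _ d) -tot.
set X := \sum_l trace C l in avg T *; set Y := \sum_l _ in T *.
have K : 'C(a.-1, s) <= s.+1 * 'C(a, s).
  by apply: leq_trans (leq_pmull _ (ltn0Sn s)); apply: leq_bin2l; lia.
have G := mul_bin_diag a s.
have {}T := leq_mul (leqnn s.+1) T.
rewrite !mulnDr (mulnCA s.+1 #|Ln| 'C(_,_)) -G (mulnCA s.+1 X) in T.
have H1 : (X - a * #|Ln|) * 'C(a.-1, s) <= (X - a * #|Ln|) * (s.+1 * 'C(a, s)).
  by rewrite leq_mul2l K orbT.
have e z : X * z = (X - a * #|Ln|) * z + a * #|Ln| * z by rewrite -mulnDl subnK.
rewrite e in T; rewrite e; nia.
Qed.

(** On a line of level [j], ['C(n, r.-1) <= 'C(n, j) * k ^ (r.-1 - j)], so the final degree bounds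
    limit the sum in [jensen_trace]; a quarter of the points would exceed this limit. *)
Lemma final_avail s a : valid s -> final s -> 0 < r -> k = 4 * a -> 0 < #|S| ->
  \sum_(j < r) thr j * k ^ (r.-1 - j) < d * 'C(a.-1, r.-1) ->
  4 * #|avail s| < #|S|.
Proof.
move=> [_ rl _ _ _] fin r0 ka S0 big.
have [//|SC] := ltnP (4 * #|avail s|) #|S|.
have := jensen_trace r0 ka SC; rewrite sum_trace leqNgt => /negP[].
have up y : y \in avail s ->
    \sum_(l | inc y l) 'C((trace (avail s) l).-1, r.-1) <=
    \sum_(j < r) thr j * k ^ (r.-1 - j).
  move=> yC.
  apply: (@leq_trans (\sum_(j < r) deg (avail s) (rem s) j y * k ^ (r.-1 - j))); last first.
    by apply: leq_sum => j _; rewrite leq_mul2r ltnW ?orbT //; apply: fin.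
  rewrite /deg; under [X in _ <= X]eq_bigr => j _ do rewrite big_distrl /=.
  rewrite (exchange_big_dep (inc y)) /=; last by move=> j l _ /andP[].
  apply: leq_sum => l yl; have [lr _] := rl l.
  rewrite (bigD1 (Ordinal lr)) /=; last by rewrite yl eqxx.
  apply: leq_trans (leq_addr _ _).
  have bk n i j : n <= k -> 'C(n, i + j) <= 'C(n, i) * k ^ j.
    move=> nk; elim: j => [|j IH]; first by rewrite addn0 muln1.
    rewrite expnSr mulnA addnS; apply: leq_trans (leq_mul IH nk).
    have := mul_bin_left n (i + j).
    have : (n - (i + j)) * 'C(n, i + j) <= n * 'C(n, i+j).
      by rewrite leq_mul2r leq_subr orbT.
    nia.
  have -> : 'C((trace (avail s) l).-1, r.-1) =
            'C((trace (avail s) l).-1, rem s l + (r.-1 - rem s l)).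
    by congr 'C(_, _); lia.
  by apply: bk; have := trace_le (avail s) l; lia.
apply: (@leq_ltn_trans (\sum_(y in avail s) \sum_(j < r) thr j * k ^ (r.-1 - j))).
  exact: leq_sum.
rewrite sum_nat_const ltn_mul2l big andbT.
lia.
Qed.

Theorem containers a : 0 < r -> k = 4 * a -> k <= q -> 0 < #|S| ->
  \sum_(j < r) thr j * k ^ (r.-1 - j) < d * 'C(a.-1, r.-1) ->
  exists f : {set S} -> {set S}, (forall F, 4 * #|f F| < #|S|) /\
  forall Q, line_free Q -> exists F : {set S},
    [/\ F \subset Q, #|F| * (q - k) <= r.-1 * #|S| & Q \subset F :|: f F].
Proof.
move=> r0 ka kq S0 big.
pose s0 := State setT set0 (fun=> r.-1) (fun=> 0).
have v0 : valid s0.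
  split => //=.
  - by rewrite -setI_eq0 set0I.
  - by move=> l; lia.
  - move=> j y jr _; rewrite /deg big_pred0 // => l.
    by apply/negbTE; rewrite negb_and; apply/orP; right; lia.
  - by split => //; rewrite cards0.
have [f Hf] := run v0.
(* The default [set0] makes the size bound hold also for sets [F] that arise from no run. *)
exists (fun F => if 4 * #|avail (f F)| < #|S| then avail (f F) else set0).
split => [F|Q fQ]; first by case: ifP => //; rewrite cards0.
have [||s' [vs' fs' _ cQ [Qc e]]] := Hf Q fQ.
- exact: sub0set.
- by rewrite set0U subsetT.
exists (chosen s'); split => //; first exact: valid_chosen.
by rewrite e (final_avail vs' fs' r0 ka S0 big).
Qed.

End Container.

(** * Moments of a random sequence of points *)

Lemma leq_wexp2r (a b e : nat) : a <= b -> a ^ e <= b ^ e.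
Proof. by case: e => // e ab; rewrite leq_exp2r. Qed.

Section RandomPoints.

Variables (S : finType) (m : nat).
Implicit Types (p : {ffun 'I_m -> S}) (J : {set 'I_m}).

Lemma card_constrained J (A : {set S}) :
  #|[set p : {ffun 'I_m -> S} | [forall i in J, p i \in A]]| =
  #|A| ^ #|J| * #|S| ^ (m - #|J|).
Proof.
rewrite -sum1dep_card.
pose Q (i : 'I_m) := [pred s : S | (i \in J) ==> (s \in A)].
rewrite (eq_bigl (fun p => p \in family Q)); last first.
  move=> p; apply/forallP/familyP => H i; first by apply: (H i).
  by have := H i.
have -> : \sum_(p in family Q) 1 = \prod_i \sum_(s | Q i s) 1.
  by rewrite bigA_distr_big_dep /=; apply: eq_bigr => p _; rewrite prod_nat_const exp1n.
rewrite (bigID (mem J)) /=; congr (_ * _).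
  rewrite -prod_nat_const; apply: eq_bigr => i iJ.
  by rewrite /Q /= iJ /= sum1_card.
rewrite (eq_bigr (fun=> #|S|)); last first.
  by move=> i iJ; rewrite (negbTE iJ) /= sum1_card.
have -> : m - #|J| = #|~: J| by rewrite (cardsCs (~: J)) setCK card_ord.
by rewrite -prod_nat_const; apply: eq_bigl => i; rewrite !inE.
Qed.

(** An exponential moment with weight 9 per hit. Fixing [p] on [J] fixes [U p]; the other
    coordinates are then independent, and each sums to at most [#|S| + 8 * u]. *)
Lemma sum_hits_le J (U : {ffun 'I_m -> S} -> {set S}) u : 0 < #|S| ->
  (forall p p', {in J, p =1 p'} -> U p = U p') -> (forall p, #|U p| <= u) ->
  \sum_(p : {ffun 'I_m -> S}) \prod_(i in ~: J) (1 + 8 * (p i \in U p)) <= (#|S| + 8 * u) ^ m.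
Proof.
move=> /card_gt0P[x0 _] locU leU.
(* The restriction of [p] to [J], padded by the arbitrary value [x0]. *)
pose h p : {ffun 'I_m -> S} := [ffun i => if i \in J then p i else x0].
rewrite (partition_big h (fun g => [forall i in ~: J, g i \in [set x0]])) /=; last first.
  move=> p _; apply/forallP => i; apply/implyP; rewrite !inE ffunE => /negbTE ->.
  by rewrite eqxx.
apply: (@leq_trans (\sum_(g : {ffun 'I_m -> S} | [forall i in ~: J, g i \in [set x0]])
   (#|S| + 8 * u) ^ #|~: J|)); last first.
  rewrite sum_nat_cond_const card_constrained cards1 exp1n mul1n.
  have Jm : #|~: J| <= m by rewrite -[X in _ <= X]card_ord max_card.
  rewrite -[X in _ <= _ ^ X](subnK Jm).
  by rewrite expnD leq_mul2r orbC leq_wexp2r ?leq_addr.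
apply: leq_sum => g _.
pose Q (i : 'I_m) := [pred s : S | (i \in J) ==> (s == g i)].
apply: (@leq_trans (\sum_(p in family Q) \prod_i (if i \in J then 1 else 1 + 8 * (p i \in U g)))).
  rewrite big_mkcond [X in _ <= X]big_mkcond /=; apply: leq_sum => p _.
  case: eqP => // hp.
  have agree i : i \in J -> p i = g i by move=> iJ; rewrite -hp ffunE iJ.
  have -> : p \in family Q.
    by apply/familyP => i; rewrite inE /=; apply/implyP => iJ; rewrite agree.
  rewrite (locU p g agree) [X in _ <= X](bigID (mem J)) /= [X in _ <= X * _]big1; last by move=> i ->.
  rewrite mul1n leq_eqVlt; apply/orP; left; apply/eqP.
  apply: eq_big => [i|i]; first by rewrite in_setC.
  by move=> iJ; rewrite in_setC in iJ; rewrite (negbTE iJ).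
rewrite -(bigA_distr_big_dep _ (fun i s => if i \in J then 1 else 1 + 8 * (s \in U g))).
rewrite (bigID (mem J)) /= big1 ?mul1n; last first.
  by move=> i iJ; rewrite (eq_bigl (pred1 (g i))) ?big_pred1_eq ?iJ // => s; rewrite /= iJ.
rewrite -prod_nat_const [X in _ <= X](eq_bigl (fun i => i \notin J)); last by move=> i; rewrite inE.
apply: leq_prod => i iJ; rewrite (negbTE iJ) /=.
rewrite big_split /= -big_distrr /= -sum1_card leq_add2l leq_mul2l /=.
by rewrite -big_mkcond /= sum1_card leU.
Qed.

End RandomPoints.

(** * The random sample: crowded tuples and deletion *)

Section Spread.

Variables (S Ln : finType) (inc : S -> Ln -> bool) (k r m t : nat).

Hypothesis mE : m = 60 * t.

Definition collinear (p : {ffun 'I_m -> S}) (A : {set 'I_m}) : bool :=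
  [exists l, [forall i in A, p i \in [set x | inc x l]]].

(** Sets of indices are used, so that repeated sample values need no separate treatment. *)
Definition crowded (p : {ffun 'I_m -> S}) : {set {set 'I_m}} :=
  [set A : {set 'I_m} | (#|A| == r.+1) && collinear p A].

Hypothesis card_line : forall l, #|[set x | inc x l]| = k.

Lemma sum_crowded :
  \sum_p #|crowded p| <=
  'C(m, r.+1) * (#|Ln| * (k ^ r.+1 * #|S| ^ (m - r.+1))).
Proof.
under eq_bigr => p _ do rewrite -sum1_card big_mkcond /=.
rewrite exchange_big /=.
rewrite -[X in 'C(X, _)]card_ord -card_draws -sum_nat_cond_const [X in _ <= X]big_mkcond /=.
apply: leq_sum => A _; case: ifP => cA; last first.
  by rewrite big1 // => p _; rewrite inE cA.
rewrite -sum_nat_const.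
apply: (@leq_trans (\sum_(p : {ffun 'I_m -> S}) \sum_(l : Ln)
   [forall i in A, p i \in [set x | inc x l]])).
  apply: leq_sum => p _; rewrite inE cA /=; case: ifP => // /existsP[l Hl].
  by rewrite (bigD1 l) //= Hl.
rewrite exchange_big /=; apply: leq_sum => l _.
rewrite -big_mkcond /= sum1dep_card card_constrained card_line.
by rewrite (eqP cA).
Qed.

Lemma prune p : 0 < t -> exists I : {set 'I_m}, m <= #|I| + #|crowded p| /\
  forall l, #|[set i in I | inc (p i) l]| <= r.
Proof.
move=> t0; have m0 : 0 < m by lia.
have i0 := Ordinal m0.
(* The index deleted from [A]. Were [r.+1] surviving indices on one line, they would form a crowded
   set, whose own [g A] has been deleted. *)
pose g (A : {set 'I_m}) := odflt i0 [pick i in A].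
exists (~: (g @: crowded p)); split.
  rewrite -[X in X <= _]card_ord -(cardsC (g @: crowded p)) addnC leq_add2l.
  exact: leq_imset_card.
move=> l; rewrite leqNgt; apply/negP => /card_geqP[s [us ss sub]].
pose A := [set i in s].
have inA i : (i \in A) = (i \in s) by rewrite inE.
have cA : A \in crowded p.
  rewrite inE cardsE (card_uniqP us) ss eqxx; apply/existsP; exists l.
  apply/forallP => i; apply/implyP; rewrite inA => si.
  by have := sub i si; rewrite !inE => /andP[].
have gA : g A \in A.
  rewrite /g; case: pickP => //= none.
  have /card_gt0P[i iA] : 0 < #|A| by move: cA; rewrite inE => /andP[/eqP ->].
  by have := none i; rewrite iA.
by move: gA; rewrite inA; move=> gs; have := sub _ gs; rewrite !inE imset_f.
Qed.

(** In the expansion of [(30 + 1) ^ m], each set of size at most [2 * t] has weight at least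
    [30 ^ (58 * t)]. *)
Lemma card_small_sets :
  #|[set J : {set 'I_m} | #|J| <= 2 * t]| * 30 ^ (58 * t) <= 31 ^ m.
Proof.
rewrite (_ : 31 = 30 + 1) // Pascal -sum1dep_card big_distrl /=.
have lt (J : {set 'I_m}) : #|J| < m.+1.
  by rewrite ltnS -[X in _ <= X]card_ord max_card.
rewrite (partition_big (fun J => Ordinal (lt J)) xpredT) //=.
apply: leq_sum => j _; rewrite exp1n muln1.
have [j2|j2] := leqP j (2 * t); last first.
  rewrite big_pred0 // => J; apply/negP => /andP[J2 /eqP/(congr1 val) /= e]; lia.
apply: (@leq_trans (\sum_(J : {set 'I_m} | #|J| == j) 30 ^ (m - j))).
  rewrite big_mkcond [X in _ <= X]big_mkcond /=; apply: leq_sum => J _.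
  case: ifP => // /andP[J2 /eqP e]; rewrite -{1}e /= eqxx mul1n leq_exp2l //; lia.
by rewrite sum_nat_cond_const card_draws card_ord.
Qed.

(** * Samples captured by a union of two containers *)

Variable U : {set S} -> {set S} -> {set S}.
Variable u : nat.
Hypothesis card_U : forall F1 F2 : {set S}, #|F1| <= 2 * t -> #|F2| <= 2 * t -> #|U F1 F2| <= u.

(** Fingerprints are given as images of index sets, so the union bound runs over small subsets of
    ['I_m] instead of subsets of [S]. *)
Definition hits (p : {ffun 'I_m -> S}) (J : {set 'I_m} * {set 'I_m}) :=
  [set i | p i \in U (p @: J.1) (p @: J.2)].

(** Markov's inequality for [sum_hits_le]: the at most [4 * t] indices that determine [U] are set
    aside, which leaves [53 * t] hits. *)
Lemma card_captured_by (J : {set 'I_m} * {set 'I_m}) :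
  0 < #|S| -> #|J.1| <= 2 * t -> #|J.2| <= 2 * t ->
  #|[set p | 57 * t <= #|hits p J|]| * 9 ^ (53 * t) <= (#|S| + 8 * u) ^ m.
Proof.
move=> S0 J1 J2; pose K := J.1 :|: J.2.
have cK : #|K| <= 4 * t by have := cardsUI J.1 J.2; rewrite /K; lia.
have := @sum_hits_le S m K (fun p => U (p @: J.1) (p @: J.2)) u S0.
move=> H; apply: leq_trans (H _ _) => {H}; last first.
- by move=> p; apply: card_U; apply: leq_trans (leq_imset_card _ _) _.
- move=> p p' e; congr (U _ _); apply: eq_in_imset => i iJ; apply: e;
    by rewrite inE iJ ?orbT.
rewrite -sum_nat_cond_const big_mkcond /=; apply: leq_sum => p _; case: ifP => // hp.
rewrite (bigID (fun i => i \in hits p J)) /= (eq_bigr (fun=> 9)); last first.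
  by move=> i /andP[_]; rewrite inE => ->.
rewrite [X in _ <= _ * X]big1 ?muln1; last first.
  by move=> i /andP[_]; rewrite inE => /negbTE ->.
rewrite prod_nat_const leq_exp2l //.
rewrite (@eq_card _ _ (hits p J :\: K)); last first.
  by move=> i; rewrite !inE unfold_in /= !inE.
have hK := leq_trans (subset_leq_card (subsetIr (hits p J) K)) cK.
have {}hp : 57 * t <= #|hits p J :&: K| + #|hits p J :\: K| by rewrite cardsID.
move: hK hp; set x := #|_|; set y := #|_|; lia.
Qed.

Definition captured : {set {ffun 'I_m -> S}} :=
  [set p | [exists J : {set 'I_m} * {set 'I_m},
    [&& #|J.1| <= 2 * t, #|J.2| <= 2 * t & 57 * t <= #|hits p J|]]].

Lemma card_captured : 0 < #|S| ->
  #|captured| * (9 ^ (53 * t) * 30 ^ (116 * t)) <=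
  31 ^ (120 * t) * (#|S| + 8 * u) ^ m.
Proof.
move=> S0; pose small := [set J : {set 'I_m} | #|J| <= 2 * t].
have ub : #|captured| <= \sum_(J in setX small small) #|[set p | 57 * t <= #|hits p J|]|.
  rewrite -sum1dep_card.
  under [X in _ <= X]eq_bigr => J _ do rewrite -sum1dep_card big_mkcond.
  rewrite exchange_big /= big_mkcond; apply: leq_sum => p _ /=.
  case: ifP => // /existsP[J /and3P[J1 J2 hJ]].
  by rewrite (bigD1 J) ?hJ //= !inE J1.
have {}ub : #|captured| * 9 ^ (53 * t) <= #|small| * #|small| * (#|S| + 8 * u) ^ m.
  apply: leq_trans (leq_mul ub (leqnn _)) _.
  rewrite -cardsX -sum_nat_const big_distrl; apply: leq_sum => J.
  by rewrite !inE => /andP[J1 J2]; apply: card_captured_by.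
rewrite mulnA; apply: leq_trans (leq_mul ub (leqnn _)) _.
rewrite mulnAC leq_mul2r; apply/orP; right.
have -> : 116 * t = 58 * t + 58 * t by lia.
have -> : 120 * t = m + m by lia.
by rewrite (expnD 30 (58 * t)) (expnD 31 m) mulnACA; apply: leq_mul; apply: card_small_sets.
Qed.

(** Raises the numerical inequality for one unit of [t] to the power [t]; its spare factor 2 becomes
    [2 ^ t >= 2]. *)
Lemma amplify (x n V p q s c g e : nat) : 0 < t -> 0 < p * q * c ^ e ->
  x * (p ^ t * q ^ t) <= s ^ t * V ^ (e * t) -> c * V <= g * n ->
  2 * (s * g ^ e) <= p * q * c ^ e -> 2 * x <= n ^ (e * t).
Proof.
move=> t0 pos hx hV rate.
have Bpos : 0 < (p * q * c ^ e) ^ t by rewrite expn_gt0 pos.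
rewrite -(leq_pmul2r Bpos).
apply: (@leq_trans (2 * (s * g ^ e) ^ t * n ^ (e * t))).
  have -> : 2 * x * (p * q * c ^ e) ^ t = 2 * (x * (p ^ t * q ^ t) * c ^ (e * t)).
    by rewrite !expnMn -expnM !mulnA.
  have -> : 2 * (s * g ^ e) ^ t * n ^ (e * t) = 2 * (s ^ t * (g ^ (e * t) * n ^ (e * t))).
    by rewrite expnMn -expnM !mulnA.
  rewrite leq_mul2l /=; apply: leq_trans (leq_mul hx (leqnn _)) _.
  by rewrite -mulnA leq_mul2l -!expnMn mulnC leq_wexp2r ?orbT.
rewrite mulnC leq_mul2l; apply/orP; right; apply: leq_trans (leq_wexp2r t rate).
by rewrite (expnMn 2) leq_mul2r -{1}(expn1 2) leq_exp2l // t0 orbT.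
Qed.

(* With e = 60 indices per unit t: 31^120 / 30^116 bounds the number of pairs of index
   sets of size at most 2t, and (51/10)^60 / 9^53 is Markov's inequality for 9^hits. *)
Lemma capture_rate : 2 * (31 ^ 120 * 51 ^ 60) <= 9 ^ 53 * 30 ^ 116 * 10 ^ 60.
Proof. lia. Qed.

Lemma card_captured_half : 0 < t -> 0 < #|S| -> 10 * (#|S| + 8 * u) <= 51 * #|S| ->
  2 * #|captured| <= #|S| ^ m.
Proof.
move=> t0 S0 uS; have := card_captured S0.
rewrite (expnM 9 53 t) (expnM 30 116 t) (expnM 31 120 t).
move: #|captured| => x; rewrite mE => H; apply: (amplify t0 _ H uS capture_rate).
lia.
Qed.

(** The mean number of crowded sets is at most [m * d / ((r.+1)! * E ^ r) <= m / 40 = 3 * t / 2]. *)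
Lemma sum_crowded_le d E : 0 < d -> #|S| = m * k * E -> r < m ->
  #|Ln| * k = d * #|S| -> 40 * d <= (r.+1)`! * E ^ r ->
  2 * \sum_p #|crowded p| <= 3 * t * #|S| ^ m.
Proof.
move=> d0 nE rm dc dE.
rewrite -(leq_pmul2l (_ : 0 < 20 * d)) ?muln_gt0 //.
have -> : 20 * d * (3 * t * #|S| ^ m) = m * d * #|S| ^ m by rewrite mE; lia.
have -> x : 20 * d * (2 * x) = 40 * d * x by lia.
apply: leq_trans (leq_mul dE sum_crowded) _.
rewrite mulnACA (mulnC _`! 'C(_, _)) bin_ffact.
have -> x : #|Ln| * (k ^ r.+1 * x) = d * #|S| * k ^ r * x by rewrite -dc expnS; lia.
apply: (@leq_trans (m ^ r.+1 * (E ^ r * (d * #|S| * k ^ r * #|S| ^ (m - r.+1))))).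
  rewrite leq_mul2r; apply/orP; right.
  rewrite ffact_prod -[X in _ ^ X]card_ord -prod_nat_const; apply: leq_prod => i _; lia.
have -> : #|S| ^ m = #|S| ^ r * (#|S| * #|S| ^ (m - r.+1)).
  by rewrite -expnS -expnD; congr (_ ^ _); lia.
have -> : #|S| ^ r = m ^ r * k ^ r * E ^ r by rewrite {1}nE !expnMn.
rewrite expnS; lia.
Qed.

(** By Markov's inequality fewer than half of the samples have more than [3 * t] crowded sets, and
    at most half are captured. *)
Lemma sample_exists d E : 0 < t -> 0 < d -> 0 < #|S| -> #|S| = m * k * E -> r < m ->
  #|Ln| * k = d * #|S| -> 40 * d <= (r.+1)`! * E ^ r ->
  10 * (#|S| + 8 * u) <= 51 * #|S| ->
  exists p, #|crowded p| <= 3 * t /\ p \notin captured.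
Proof.
move=> t0 d0 S0 nE rm dc dE uS.
pose bad := [set p | 3 * t < #|crowded p|].
have cap2 := card_captured_half t0 S0 uS.
have sc := sum_crowded_le d0 nE rm dc dE.
have bad2 : 2 * #|bad| < #|S| ^ m.
  rewrite -(ltn_pmul2l (_ : 0 < (3 * t).+1)) // mulnCA.
  apply: (@leq_ltn_trans (3 * t * #|S| ^ m)); last by rewrite ltn_mul2r expn_gt0 S0 ltnSn.
  apply: leq_trans sc; rewrite leq_mul2l /= mulnC -sum_nat_const big_mkcond /=.
  by apply: leq_sum => p _; rewrite inE; case: ifP.
case: (pickP (fun p => p \notin bad :|: captured)) => [p|all].
  by rewrite !inE negb_or -leqNgt => /andP[h1 h2]; exists p; split; rewrite ?inE.
have : #|[set: {ffun 'I_m -> S}]| <= #|bad :|: captured|.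
  by apply: subset_leq_card; apply/subsetP => p _; have /negbFE := all p.
move/leq_trans => /(_ _ (leq_card_setU _ _)); rewrite cardsT card_ffun card_ord.
move: cap2 bad2; move: #|bad| #|captured| (#|S| ^ m) => x y z; lia.
Qed.

End Spread.

(** * Combining containers with the random sample *)

(** One index is kept per point of [F]; this turns a fingerprint inside the sample into an index set
    that is no larger. *)
Lemma imset_section (I S : finType) (p : I -> S) (F : {set S}) (J : {set I}) :
  F \subset p @: J -> exists J' : {set I}, p @: J' = F /\ #|J'| <= #|F|.
Proof.
move=> FJ; pose g x := [pick i in J | p i == x].
have gF x : x \in F -> exists2 i, g x = Some i & p i = x.
  move=> /(subsetP FJ) /imsetP[i iJ ->]; rewrite /g.
  by case: pickP => [j /andP[_ /eqP e]|/(_ i)]; [exists j | rewrite iJ eqxx].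
exists [set i | (p i \in F) && (g (p i) == Some i)]; split.
  apply/setP => x; apply/imsetP/idP => [[i] |xF]; first by rewrite inE => /andP[pF _] ->.
  by have [i gi pi] := gF x xF; exists i => //; rewrite inE pi gi xF eqxx.
rewrite -(card_in_imset (f := p)).
  by apply: subset_leq_card; apply/subsetP => x /imsetP[i]; rewrite inE => /andP[? _] ->.
move=> i j; rewrite !inE => /andP[_ /eqP gi] /andP[_ /eqP gj] e.
by move: gi; rewrite e gj => -[].
Qed.

Lemma indecomposable_subset (S Ln : finType) (inc : S -> Ln -> bool)
    (k d r q a E t : nat) :
  (forall l, #|[set x | inc x l]| = k) -> (forall x, #|[set l | inc x l]| = d) ->
  (forall x y l l', x != y -> inc x l -> inc y l -> inc x l' -> inc y l' -> l = l') ->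
  0 < t -> 0 < d -> 1 < r < 60 * t -> k = 4 * a -> 1 < a -> 0 < E ->
  #|S| = 60 * t * k * E ->
  30 * r.-1 * k * E + k <= q ->
  \sum_(j < r) thr k q j * k ^ (r.-1 - j) < d * 'C(a.-1, r.-1) ->
  40 * d <= (r.+1)`! * E ^ r ->
  exists P : {set S}, (forall l, trace inc P l <= r) /\
    forall Q : {set S}, Q \subset P ->
      exists l, trace inc Q l = r \/ trace inc (P :\: Q) l = r.
Proof.
move=> cl cp tp t0 d0 /andP[r1 rm] ka a1 E0 nE hq big dE.
have r0 := ltnW r1; have k0 : 0 < k by lia.
have S0 : 0 < #|S| by rewrite nE !muln_gt0 t0 k0 E0.
have kq := leq_trans (leq_addl _ _) hq.
have [f [fsmall fcont]] := containers cl tp cp r0 ka kq S0 big.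
pose U (F1 F2 : {set S}) := (F1 :|: f F1) :|: (F2 :|: f F2).
pose u := 4 * t + (#|S| %/ 4) * 2.
have cU (F1 F2 : {set S}) : #|F1| <= 2 * t -> #|F2| <= 2 * t -> #|U F1 F2| <= u.
  move=> h1 h2.
  apply: leq_trans (leq_card_setU _ _) _.
  apply: leq_trans (leq_add (leq_card_setU _ _) (leq_card_setU _ _)) _.
  have := fsmall F1; have := fsmall F2; rewrite /u; lia.
(* The containers account for [1 + 8 / 2 = 5]; the remaining [1 / 10] absorbs the fingerprint term
   [32 * t], as [#|S| >= 360 * t]. *)
have uS : 10 * (#|S| + 8 * u) <= 51 * #|S|.
  have kE : 6 <= k * E by have := leq_mul (leqnn k) E0; lia.
  have := leq_mul (leqnn (60 * t)) kE; rewrite mulnA -nE /u; lia.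
have [p [cr ncap]] := sample_exists erefl cl cU t0 d0 S0 nE rm
  (double_count cl cp) dE uS.
have [I [cI fewI]] := prune inc r erefl p t0.
have Pr l : trace inc (p @: I) l <= r.
  apply: leq_trans (fewI l); apply: leq_trans (leq_imset_card p _).
  apply: subset_leq_card; apply/subsetP => x; rewrite inE => /andP[/imsetP[i iI ->] il].
  by apply: imset_f; rewrite inE iI.
exists (p @: I); split => // Q QP.
case: (pickP (fun l => (trace inc Q l == r) || (trace inc (p @: I :\: Q) l == r))).
  by move=> l /orP[] /eqP h; exists l; [left|right].
move=> none; case/negP: ncap; rewrite inE; apply/existsP.
have free (R : {set S}) : R \subset p @: I -> (forall l, (trace inc R l == r) = false) ->
    line_free inc r R.
  by move=> RP ne l; rewrite ltn_neqAle ne (leq_trans (traceS inc l RP) (Pr l)).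
have Fle (F : {set S}) : #|F| * (q - k) <= r.-1 * #|S| -> #|F| <= 2 * t.
  rewrite nE => h; have D0 : 0 < r.-1 * k * E by rewrite !muln_gt0 k0 E0; lia.
  have D : 30 * (r.-1 * k * E) <= q - k by lia.
  rewrite -(leq_pmul2r (_ : 0 < q - k)); last by lia.
  by apply: leq_trans h (leq_trans _ (leq_mul (leqnn (2 * t)) D)); lia.
have [|F1 [F1Q F1c QF1]] := fcont Q (free Q QP _).
  by move=> l; have := none l; case: eqP.
have [|F2 [F2Q F2c QF2]] := fcont (p @: I :\: Q) (free _ (subsetDl _ _) _).
  by move=> l; have := none l; rewrite orbC; case: eqP.
have [J1 [e1 c1]] := imset_section (subset_trans F1Q QP).
have [J2 [e2 c2]] := imset_section (subset_trans F2Q (subsetDl _ _)).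
exists (J1, J2); rewrite /= (leq_trans c1) ?(leq_trans c2) ?Fle //=.
(* At least [60 * t - 3 * t] indices survive deletion, and every one of them is a hit, since [Q] and
   its complement are both contained. *)
apply: (@leq_trans #|I|); first by move: cI cr; lia.
apply: subset_leq_card; apply/subsetP => i iI; rewrite inE /= e1 e2 /U inE.
have pP : p i \in p @: I by apply: imset_f.
have [iQ|iQ] := boolP (p i \in Q); first by rewrite (subsetP QF1).
by rewrite (subsetP QF2) ?orbT // inE iQ.
Qed.

(** * The grid and its axis-parallel lines *)

Section Grid.

Variables (d k : nat).

Notation grid := {ffun 'I_d -> 'I_k.+1}.

Definition update (x : grid) (i : 'I_d) (v : 'I_k.+1) : grid :=
  [ffun j => if j == i then v else x j].

(* A line is a direction together with its point in the corresponding coordinate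
   hyperplane. *)
Definition axis_line := {l : 'I_d * grid | l.2 l.1 == ord0}.

Definition on_axis_line (x : grid) (l : axis_line) : bool :=
  update x (val l).1 ord0 == (val l).2.

Lemma on_axis_lineP (x : grid) (l : axis_line) :
  reflect (forall j, j != (val l).1 -> x j = (val l).2 j) (on_axis_line x l).
Proof.
apply: (iffP eqP) => [<- j nj|H]; first by rewrite ffunE (negbTE nj).
apply/ffunP => j; rewrite ffunE; case: eqP => [->|/eqP/H //].
by rewrite (eqP (valP l)).
Qed.

Lemma card_axis_line l : #|[set x | on_axis_line x l]| = k.+1.
Proof.
have -> : [set x | on_axis_line x l] =
    [set update (val l).2 (val l).1 v | v in [set: 'I_k.+1]].
  apply/setP => x; rewrite inE; apply/on_axis_lineP/imsetP => [H|[v _ -> j nj]].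
    exists (x (val l).1) => //; apply/ffunP => j; rewrite ffunE.
    by case: eqP => [->|/eqP/H].
  by rewrite ffunE (negbTE nj).
rewrite card_imset ?cardsT ?card_ord // => v w /ffunP/(_ (val l).1).
by rewrite !ffunE eqxx.
Qed.

Lemma card_axis_pencil (x : grid) : #|[set l | on_axis_line x l]| = d.
Proof.
have sub i : (i, update x i ord0).2 (i, update x i ord0).1 == ord0.
  by rewrite /= ffunE eqxx.
have -> : [set l | on_axis_line x l] =
    [set (Sub (i, update x i ord0) (sub i) : axis_line) | i in [set: 'I_d]].
  apply/setP => l; rewrite inE; apply/eqP/imsetP => [H|[i _ ->]].
    exists (val l).1 => //; apply: val_inj; rewrite /= H.
    exact: surjective_pairing.
  by [].
rewrite card_imset ?cardsT ?card_ord // => i j /(congr1 val) /=.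
by case.
Qed.

(** With two different directions, [x] and [y] would agree in every coordinate; with equal
    directions, [x] determines the base point. *)
Lemma axis_line_unique (x y : grid) l l' : x != y -> on_axis_line x l -> on_axis_line y l ->
  on_axis_line x l' -> on_axis_line y l' -> l = l'.
Proof.
move=> nxy /[dup] /on_axis_lineP xl /eqP exl /on_axis_lineP yl.
move=> /[dup] /on_axis_lineP xl' /eqP exl' /on_axis_lineP yl'.
have e : (val l).1 = (val l').1.
  apply/eqP; apply: contraNT nxy => ne; apply/eqP/ffunP => j.
  have [jl|jl] := eqVneq j (val l).1; last by rewrite xl ?yl.
  by rewrite xl' ?yl' // jl.
apply: val_inj; move: exl exl'; rewrite e => h; rewrite h => h'.
by rewrite [LHS]surjective_pairing [RHS]surjective_pairing e h'.
Qed.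

Lemma card_grid : #|{: grid}| = k.+1 ^ d.
Proof. by rewrite card_ffun !card_ord. Qed.

End Grid.

(** * Choice of the parameters *)

(** The summand [k ^ j] lets the induction close: two copies of [k ^ j.+1] are at most
    [q * k ^ j]. *)
Lemma cap_le k q j : 2 * k <= q -> cap k q j + k ^ j <= 2 * q ^ j.
Proof.
move=> kq; elim: j => //= j IH.
have := leq_mul (leqnn q) IH; have := leq_mul kq (leqnn (k ^ j)).
rewrite !expnS; lia.
Qed.

Lemma thr_le k q j : 2 * k <= q -> thr k q j <= 2 * q ^ j.
Proof.
case: j => //= j kq; have := leq_mul (leqnn q) (cap_le j kq); rewrite expnS; lia.
Qed.

Lemma sum_thr_le k q r : 2 * k <= q ->
  \sum_(j < r.+1) thr k q j * k ^ (r - j) <= 4 * q ^ r.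
Proof.
move=> kq; elim: r => [|r IH]; first by rewrite big_ord_recl big_ord0.
rewrite big_ord_recr subnn muln1.
have -> : \sum_(j < r.+1) thr k q (widen_ord (leqnSn r.+1) j) * k ^ (r.+1 - widen_ord (leqnSn r.+1) j)
    = k * \sum_(j < r.+1) thr k q j * k ^ (r - j).
  rewrite big_distrr; apply: eq_bigr => j _ /=.
  by rewrite subSn ?expnS ?(mulnCA k) // -ltnS.
apply: leq_trans (leq_add (leq_mul (leqnn k) IH) (thr_le r.+1 kq)) _.
by have := leq_mul kq (leqnn (q ^ r)); rewrite (expnS q r); lia.
Qed.

(** Bernoulli's inequality for [(1 - r / a) ^ s], cleared of denominators, with truncated
    subtraction. *)
Lemma bernoulli a r s : a ^ s * (a - s * r) <= a * (a - r) ^ s.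
Proof.
elim: s => [|s IH]; first by rewrite !muln1 mul1n subn0.
rewrite !expnS; have := leq_mul IH (leqnn (a - r)).
have : a * (a - s.+1 * r) <= (a - s * r) * (a - r).
  have [le|/ltnW/eqP ->] := leqP (s.+1 * r) a; last by rewrite muln0.
  rewrite mulSn in le *; rewrite mulnBr !mulnBl; nia.
move=> /(leq_mul (leqnn (a ^ s))); lia.
Qed.

Lemma ffact_ge a s : (a - s) ^ s <= a ^_ s.
Proof.
rewrite ffact_prod -[X in _ ^ X]card_ord -prod_nat_const; apply: leq_prod => i _.
by have := ltn_ord i; lia.
Qed.

(** After cancelling [X ^ r] the claim is [a ^ r < 2 * (a.-1 ^_ r)], which follows from [bernoulli]
    since [a] is large against [r * r.+1]. *)
Lemma threshold_lt r a q X : 0 < q -> 2 * (r * r.+1) < a -> q = a * X ->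
  4 * q ^ r < 8 * r`! * X ^ r * 'C(a.-1, r).
Proof.
move=> q0 ra qE.
have -> : 8 * r`! * X ^ r * 'C(a.-1, r) = 8 * (X ^ r * (a.-1 ^_ r)).
  by rewrite -bin_ffact; lia.
rewrite qE expnMn.
have a0 : 0 < a by lia.
have X0 : 0 < X ^ r by rewrite expn_gt0; nia.
suff: a ^ r < 2 * (a.-1 ^_ r) by move/(leq_mul (leqnn (X ^ r))); nia.
apply: (@leq_trans (2 * (a - r.+1) ^ r)); last first.
  by rewrite leq_mul2l /= (leq_trans _ (ffact_ge _ _)) // leq_wexp2r //; lia.
rewrite -(ltn_pmul2l a0) mulnCA; apply: leq_trans (leq_mul (leqnn 2) (bernoulli a r.+1 r)).
have : 0 < a ^ r by rewrite expn_gt0 a0.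
nia.
Qed.

Lemma fact_le_exp n m : n <= m -> n`! <= m ^ n.
Proof.
elim: n => // n IH nm; rewrite factS expnS leq_mul // IH //; lia.
Qed.

Lemma indecomposable_grid_of r E a q d : 1 < r -> 0 < E -> a = 60 * E * (r * r) ->
  1 < d -> 30 * r.-1 * (4 * a) * E + 4 * a <= q -> 2 * (4 * a) <= q ->
  4 * q ^ r.-1 < d * 'C(a.-1, r.-1) -> 40 * d <= (r.+1)`! * E ^ r ->
  exists P : {set {ffun 'I_d -> 'I_(4 * a).-1.+1}},
    (forall l, trace (@on_axis_line d (4 * a).-1) P l <= r) /\
    forall Q : {set {ffun 'I_d -> 'I_(4 * a).-1.+1}}, Q \subset P ->
      exists l, trace (@on_axis_line d (4 * a).-1) Q l = r \/
                trace (@on_axis_line d (4 * a).-1) (P :\: Q) l = r.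
Proof.
move=> r1 E0 aE d2 hq kq big dE.
have a1 : 1 < a by rewrite aE; clear -r1 E0; nia.
have kE : (4 * a).-1.+1 = 4 * a by clear -a1; lia.
have cl (l : axis_line d (4 * a).-1) : #|[set x | on_axis_line x l]| = 4 * a.
  by rewrite card_axis_line kE.
(* As [4 * a] is [60 * E] times [4 * (r * r)], the grid size factors as [60 * t * (4 * a) * E] with
   [t = 4 * (r * r) * z]. *)
have [z zE] : {z | z = (4 * a) ^ (d - 2)} by exists ((4 * a) ^ (d - 2)).
have z0 : 0 < z by rewrite zE expn_gt0; clear -a1; lia.
have t0 : 0 < 4 * (r * r) * z by clear -r1 z0; nia.
have rt : 1 < r < 60 * (4 * (r * r) * z) by rewrite r1; clear -r1 z0; nia.
have nE : #|{: {ffun 'I_d -> 'I_(4 * a).-1.+1}}| = 60 * (4 * (r * r) * z) * (4 * a) * E.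
  rewrite card_grid kE -[X in _ ^ X](subnK d2) expnD -zE aE; clear; lia.
apply: (indecomposable_subset cl (@card_axis_pencil _ _) (@axis_line_unique _ _) t0
  (ltnW d2) rt erefl a1 E0 nE hq _ dE).
apply: leq_ltn_trans big; case: (r) r1 => // s _; exact: sum_thr_le.
Qed.

(** Cancelling [E ^ s] and the factorial of [s] leaves [320 * (r ^ 5) ^ s <= r.+1 * r * E], where
    [E = (r ^ 5) ^ s * r ^ 4]. *)
Lemma degree_le s E r : 1 < s -> r = s.+1 -> E = r ^ (5 * r - 1) ->
  40 * (8 * s`! * (r ^ 5 * E) ^ s) <= (r.+1)`! * E ^ r.
Proof.
move=> s1 rE EE.
have h : 320 * (r ^ 5) ^ s <= (r.+1 * r) * E.
  have -> : E = (r ^ 5) ^ s * r ^ 4.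
    by rewrite -expnM -expnD EE; congr (_ ^ _); rewrite rE; lia.
  rewrite mulnCA mulnC leq_mul2l; apply/orP; right.
  rewrite rE -(subnK s1) !expnS expn0; move: (s - 2) => v; clear; nia.
have -> : E ^ r = E * E ^ s by rewrite rE expnS.
have -> : (r.+1)`! = r.+1 * r * s`! by rewrite rE !factS mulnA.
by have := leq_mul (leq_mul h (leqnn s`!)) (leqnn (E ^ s)); rewrite expnMn; lia.
Qed.

(** The power [(r ^ 5 * E) ^ s] has exponent [5r^2 - r - 4]; the missing [r + 4] is split as
    [2 + s + 3] to cover 8, the factorial and the last factor [s]. *)
Lemma neighbours_le s E r : 1 < s -> r = s.+1 -> E = r ^ (5 * r - 1) ->
  8 * s`! * (r ^ 5 * E) ^ s * s <= r ^ (5 * (r * r)).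
Proof.
move=> s1 rE EE.
have -> : r ^ (5 * (r * r)) = (r ^ 5 * E) ^ s * (r ^ 2 * r ^ s * r ^ 3).
  rewrite EE -!expnD -expnM -expnD; congr (_ ^ _); rewrite rE; nia.
rewrite mulnAC mulnC leq_mul2l; apply/orP; right.
have r3 : 2 < r by rewrite rE.
apply: leq_mul; first apply: leq_mul.
- by rewrite !expnS expn0; clear -r3; nia.
- by apply: fact_le_exp; rewrite rE.
by rewrite !expnS expn0 {1}(_ : s = r.-1) ?rE //; clear; nia.
Qed.

(* E = r^(5r-1) balances the two constraints on d: 40 d <= (r+1)! E^r for the deletion,
   and d > 4 q^(r-1) / 'C(a-1, r-1) with q = a r^5 E for the containers. *)
Theorem indecomposable_grid r : 2 < r -> exists d k (P : {set {ffun 'I_d -> 'I_k.+1}}),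
  [/\ d * r.-1 <= r ^ (5 * (r * r)), forall l, trace (@on_axis_line d k) P l <= r &
    forall Q : {set {ffun 'I_d -> 'I_k.+1}}, Q \subset P ->
      exists l, trace (@on_axis_line d k) Q l = r \/
                trace (@on_axis_line d k) (P :\: Q) l = r].
Proof.
case: r => // s s1; have [r rE] : {r | r = s.+1} by exists s.+1.
have [E EE] : {E | E = r ^ (5 * r - 1)} by exists (r ^ (5 * r - 1)).
have [a aE] : {a | a = 60 * E * (r * r)} by exists (60 * E * (r * r)).
have [X XE] : {X | X = r ^ 5 * E} by exists (r ^ 5 * E).
have [d dE] : {d | d = 8 * s`! * X ^ s} by exists (8 * s`! * X ^ s).
have E3 : 3 <= E.
  rewrite EE (_ : 5 * r - 1 = (5 * r - 2).+1) ?expnS; last by rewrite rE; lia.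
  by rewrite -[3]muln1; apply: leq_mul; rewrite ?expn_gt0 rE.
(* This makes [q = a * X] large enough for small fingerprints. The inequality [120 * s + 3 <= r ^ 5]
   is an equality at [r = 3]. *)
have X4 : 120 * s * E + 4 <= X.
  have : 120 * s + 3 <= r ^ 5.
    by rewrite rE -(subnK s1) !expnS; move: (s - 2) => v; clear; nia.
  by move/leq_mul => /(_ _ _ (leqnn E)); rewrite -XE; clear -E3; lia.
have a0 : 0 < a by rewrite aE rE; clear -E3; nia.
have d2 : 1 < d.
  have : 0 < X ^ s by rewrite expn_gt0; clear -X4; lia.
  by rewrite dE; have := fact_gt0 s; clear; nia.
have hq : 30 * s * (4 * a) * E + 4 * a <= a * X.
  by have := leq_mul (leqnn a) X4; clear; lia.
have kq : 2 * (4 * a) <= a * X.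
  have X8 : 8 <= X by clear -X4 E3 s1; nia.
  by have := leq_mul (leqnn a) X8; clear; lia.
rewrite -rE; exists d, (4 * a).-1.
have sr : r.-1 = s by rewrite rE.
have r1 : 1 < r by rewrite rE; clear -s1; lia.
have E0 : 0 < E by clear -E3; lia.
have [|||P [P1 P2]] := @indecomposable_grid_of r E a (a * X) d r1 E0 aE d2 _ kq.
- by rewrite sr.
- rewrite sr dE; apply: threshold_lt => //.
    by rewrite muln_gt0 a0; clear -X4; lia.
  by rewrite aE rE; clear -E0; nia.
- by rewrite dE XE; apply: degree_le.
exists P; split => //; rewrite sr dE XE; exact: neighbours_le.
Qed.

(** * The map from the grid to the plane *)

Lemma digits_unique B d (a b : 'I_d -> nat) :
  (forall j, a j < B) -> (forall j, b j < B) ->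
  \sum_(j < d) a j * B ^ j = \sum_(j < d) b j * B ^ j -> a =1 b.
Proof.
elim: d a b => [|d IH] a b aB bB; first by move=> _ [].
have shift (c : 'I_d.+1 -> nat) : \sum_(j < d.+1) c j * B ^ j =
    (\sum_(j < d) c (lift ord0 j) * B ^ j) * B + c ord0.
  rewrite big_ord_recl muln1 addnC big_distrl; congr (_ + _); apply: eq_bigr => j _.
  by rewrite /= /bump /= add1n expnSr mulnA.
rewrite !shift => e.
have e0 : a ord0 = b ord0.
  by have := congr1 (modn^~ B) e; rewrite !modnMDl !modn_small.
have B0 : 0 < B by apply: leq_ltn_trans (aB ord0).
move/eqP: e; rewrite e0 eqn_add2r eqn_pmul2r // => /eqP e.
move=> j; have [->//|j0] := eqVneq j ord0.
have [i ->] : exists i, j = lift ord0 i.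
  by case: (unliftP ord0 j) j0 => [i ->|->]; [exists i | rewrite eqxx].
exact: (IH (fun i => a (lift ord0 i)) (fun i => b (lift ord0 i))).
Qed.

Lemma INR_addn m n : INR (m + n) = (INR m + INR n)%Re.
Proof. exact: plus_INR. Qed.

Lemma INR_muln m n : INR (m * n) = (INR m * INR n)%Re.
Proof. exact: mult_INR. Qed.

Section Plane.

Variables d k : nat.

Notation grid := {ffun 'I_d -> 'I_k.+1}.

(** The digits compared in [on_plane_line] are a coordinate plus possibly a weight, hence at most
    [k + d * k]. *)
Definition base : nat := (d.+1 * k).+1.
Definition weight (x : grid) : nat := \sum_(j < d) x j.
Definition height (x : grid) : nat := \sum_(j < d) x j * base ^ j.

Definition plane_point (x : grid) : point := (INR (weight x), INR (height x)).

Lemma minus_one_nondeg (c : R) : c <> 0%Re \/ (-1)%Re <> 0%Re.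
Proof. by right; apply: Rlt_not_eq; apply: IZR_lt. Qed.

Definition plane_line (l : axis_line d k) : line :=
  @Line (INR (base ^ (val l).1)) (-1)%Re
    (INR (base ^ (val l).1) * INR (weight (val l).2) - INR (height (val l).2))%Re
    (minus_one_nondeg _).

Lemma weight_le x : weight x <= d * k.
Proof.
rewrite -[X in X * _]card_ord -sum_nat_const; apply: leq_sum => j _.
by rewrite -ltnS.
Qed.

Lemma plane_point_inj : injective plane_point.
Proof.
move=> x y [_ /INR_eq e]; apply/ffunP => j; apply: val_inj.
by apply: (digits_unique _ _ e) => i; rewrite ltnS mulSn;
  apply: leq_trans (leq_addr _ _); rewrite -ltnS; apply: ltn_ord.
Qed.

(* With b the base point of l and i its direction, the equation reads
   B^i weight x + height b = B^i weight b + height x. Both sides are base-B expansions, in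
   which the weights are absorbed by digit i; the other digits must therefore agree. *)
Lemma on_plane_line x l : on_line (plane_line l) (plane_point x) <-> on_axis_line x l.
Proof.
case: l => -[i b] bi; rewrite /on_line /=.
have eqn : (INR (base ^ i) * INR (weight x) + -1 * INR (height x) =
    INR (base ^ i) * INR (weight b) - INR (height b))%Re <->
    base ^ i * weight x + height b = base ^ i * weight b + height x.
  split=> [e|/(congr1 INR)]; first apply: INR_eq; rewrite !INR_addn !INR_muln; lra.
rewrite eqn; split => [e|/on_axis_lineP /= H]; last first.
  have W z : weight z = z i + \sum_(j < d | j != i) z j by rewrite /weight (bigD1 i).
  have Z z : height z = z i * base ^ i + \sum_(j < d | j != i) z j * base ^ j.
    by rewrite /height (bigD1 i).
  have Wx : \sum_(j < d | j != i) x j = \sum_(j < d | j != i) b j.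
    by apply: eq_bigr => j /H ->.
  have Zx : \sum_(j < d | j != i) x j * base ^ j = \sum_(j < d | j != i) b j * base ^ j.
    by apply: eq_bigr => j /H ->.
  by rewrite !W !Z Wx Zx; lia.
apply/on_axis_lineP => /= j ji.
pose c (y z : grid) (j : 'I_d) := y j + (j == i) * weight z.
have cB y z j' : c y z j' < base.
  rewrite /base /c ltnS mulSn; apply: leq_add; first by rewrite -ltnS; apply: ltn_ord.
  by case: (j' == i); rewrite ?mul1n ?weight_le.
have sum_c y z : \sum_(j < d) c y z j * base ^ j = base ^ i * weight z + height y.
  under eq_bigr => j' _ do rewrite mulnDl.
  rewrite big_split /= addnC; congr (_ + _).
  rewrite (bigD1 i) //= eqxx mul1n big1 ?addn0 1?mulnC //.
  by move=> j' /negbTE ->.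
have := digits_unique (cB b x) (cB x b).
rewrite !sum_c => /(_ e j); rewrite /c (negbTE ji) !addn0 => h.
by apply: val_inj.
Qed.

End Plane.

(** * The planar configuration *)

Lemma In_mem (T : eqType) (x : T) (s : seq T) : List.In x s <-> x \in s.
Proof.
elim: s => //= y s IH; rewrite inE IH; split.
  by case=> [->|->]; rewrite ?eqxx ?orbT.
by case/orP => [/eqP ->|]; [left | right].
Qed.

Lemma uniq_NoDup (T : eqType) (s : seq T) : uniq s -> List.NoDup s.
Proof.
elim: s => [|x s IH] /=; first by constructor.
by case/andP => xs /IH; constructor => // /In_mem; apply/negP.
Qed.

Section Realization.

Variables (d k r : nat) (P : {set {ffun 'I_d -> 'I_k.+1}}).

Notation grid := {ffun 'I_d -> 'I_k.+1}.
Notation tr := (trace (@on_axis_line d k)).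

Hypothesis few : forall l, tr P l <= r.

Definition rich_lines : list line :=
  List.map (@plane_line d k) (enum [set l : axis_line d k | tr P l == r]).

Definition points_of (A : {set grid}) : list point :=
  List.map (@plane_point d k) (enum A).

Lemma In_points (A : {set grid}) q :
  List.In q (points_of A) <-> exists2 x, x \in A & q = plane_point x.
Proof.
rewrite List.in_map_iff; split=> [[x [<- /In_mem]]|[x xA ->]].
  by rewrite mem_enum; exists x.
by exists x; split => //; apply/In_mem; rewrite mem_enum.
Qed.

Lemma In_rich l : List.In l rich_lines <-> exists2 m, tr P m = r & l = plane_line m.
Proof.
rewrite List.in_map_iff; split=> [[m [<- /In_mem]]|[m mr ->]].
  by rewrite mem_enum inE => /eqP; exists m.
by exists m; split => //; apply/In_mem; rewrite mem_enum inE mr.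
Qed.

Lemma NoDup_points (A : {set grid}) : List.NoDup (points_of A).
Proof.
apply: FinFun.Injective_map_NoDup; last exact/uniq_NoDup/enum_uniq.
exact: plane_point_inj.
Qed.

Lemma length_points (A : {set grid}) : length (points_of A) = #|A|.
Proof. by rewrite List.length_map cardE. Qed.

Lemma rich_lines_have l : List.In l rich_lines -> line_has_at_least (points_of P) l r.
Proof.
case/In_rich => m mr ->; exists (points_of [set x in P | on_axis_line x m]).
split; first exact: NoDup_points.
split; first by apply/leP; rewrite length_points -[X in X <= _]mr.
move=> q /In_points[x]; rewrite inE => /andP[xP xm] ->; split; last exact/on_plane_line.
by apply/In_points; exists x.
Qed.

(** Each of the [d] axis lines through a grid point carries at most [r.-1] further points of [P]. *)
Lemma rich_lines_share T p : d * r.-1 <= T -> List.In p (points_of P) ->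
  shares_line_with_at_most rich_lines (points_of P) p T.
Proof.
move=> dT /In_points[x xP ->] s us sub.
pose N := \bigcup_(l | on_axis_line x l) ([set y in P | on_axis_line y l] :\ x).
apply/leP; apply: leq_trans dT; apply: (@leq_trans #|N|).
  rewrite -length_points; apply/leP; apply: List.NoDup_incl_length => // q /sub.
  case=> /In_points[y yP ->] [nyx [_ [/In_rich[m _ ->] [/on_plane_line xm /on_plane_line ym]]]].
  apply/In_points; exists y => //; apply/bigcupP; exists m => //.
  by rewrite !inE yP ym /= andbT; apply/eqP => e; apply: nyx; rewrite e.
apply: (@leq_trans (\sum_(l | on_axis_line x l) r.-1)); last first.
  by rewrite sum_nat_cond_const card_axis_pencil.
rewrite /N; apply: (big_ind2 (fun (A : {set grid}) n => #|A| <= n)).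
- by rewrite cards0.
- by move=> A m B n Am Bn; apply: leq_trans (leq_card_setU _ _) (leq_add Am Bn).
move=> l xl; have xin : x \in [set y in P | on_axis_line y l] by rewrite inE xP.
have := few l; rewrite {1}/trace [X in X <= r](cardsD1 x) xin add1n.
by case: (r).
Qed.

(** If one class has [r] points on a line, then by [few] these are all points of [P] there; so the
    line is rich and misses the other class. *)
Lemma rich_lines_indecomposable :
  (forall Q : {set grid}, Q \subset P -> exists l, tr Q l = r \/ tr (P :\: Q) l = r) ->
  ~ decomposable_two_covers rich_lines (points_of P).
Proof.
move=> mono [P1 cover].
pose Q := [set x in P | excluded_middle_informative (P1 (plane_point x))].
have QP : Q \subset P by apply/subsetP => x; rewrite inE => /andP[].
have full (A : {set grid}) l : A \subset P -> tr A l = r ->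
    tr P l = r /\ forall x, x \in P -> on_axis_line x l -> x \in A.
  move=> AP Ar; have Pr : tr P l = r.
    by apply/eqP; rewrite eqn_leq few -{1}Ar traceS.
  split => // x xP xl.
  have : [set x in A | on_axis_line x l] == [set x in P | on_axis_line x l].
    rewrite eqEcard; apply/andP; split; last by rewrite -[X in X <= _]/(tr P l) Pr -Ar.
    by apply/subsetP => y; rewrite !inE => /andP[/(subsetP AP) -> ->].
  by move/eqP/setP/(_ x); rewrite !inE xP xl /= andbT.
have witness l : tr P l = r -> (exists x, [/\ x \in P, on_axis_line x l & P1 (plane_point x)]) /\
    exists x, [/\ x \in P, on_axis_line x l & ~ P1 (plane_point x)].
  move=> Pr; have /cover[] : List.In (plane_line l) rich_lines by apply/In_rich; exists l.
  move=> [_ [/In_points[x xP ->] [/on_plane_line xl px]]].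
  move=> [_ [/In_points[y yP ->] [/on_plane_line yl py]]].
  by split; [exists x | exists y].
have [l [h|h]] := mono Q QP.
  have [/witness[_ [x [xP xl px]]] inA] := full Q l QP h.
  by have := inA x xP xl; rewrite inE => /andP[_]; case: excluded_middle_informative.
have [/witness[[x [xP xl px]] _] inA] := full _ l (subsetDl P Q) h.
by have := inA x xP xl; rewrite !inE xP /= andbT; case: excluded_middle_informative.
Qed.

End Realization.

Lemma indecomposable_lines r : 2 < r -> exists (L : list line) (P : list point),
  List.NoDup P /\
  (forall l, List.In l L -> line_has_at_least P l r) /\
  (forall p, List.In p P -> shares_line_with_at_most L P p (Nat.pow r (5 * (r * r)))) /\
  ~ decomposable_two_covers L P.
Proof.
move=> /indecomposable_grid[d [k [P [dT few mono]]]].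
have {}dT : d * r.-1 <= Nat.pow r (5 * (r * r)).
  apply: leq_trans dT _; apply: eq_leq; rewrite -[RHS]/(Nat.pow r _).
  by elim: (5 * _) => // n IH; rewrite expnS IH.
exists (rich_lines r P), (points_of P); split; first exact: NoDup_points.
split; first exact: rich_lines_have.
split; last exact: rich_lines_indecomposable.
by move=> p; apply: rich_lines_share.
Qed.

End Combinatorics.

(** * The cases [r = 1] and [r = 2], and the conclusion *)

Lemma single_point : exists (L : list line) (P : list point),
  NoDup P /\
  (forall l, In l L -> line_has_at_least P l 1) /\
  (forall p, In p P -> shares_line_with_at_most L P p 1) /\
  ~ decomposable_two_covers L P.
Proof.
  assert (nd : 1 <> 0 \/ 0 <> 0) by lra.
  set (l := Line 1 0 0 nd); set (o := (0, 0) : point).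
  assert (ol : on_line l o) by (unfold on_line; simpl; lra).
  assert (no : NoDup (o :: nil)) by (constructor; [easy | constructor]).
  exists (l :: nil), (o :: nil); split; [exact no |]; split; [| split].
  - intros l' [<- | []]; exists (o :: nil).
    split; [exact no |]; split; [apply le_n |].
    intros q [<- | []]; split; [left |]; trivial.
  - intros p _ s ns sub; apply (NoDup_incl_length ns (l' := o :: nil)).
    intros q hq; apply (sub q hq).
  - intros [P1 cover]; destruct (cover l (or_introl eq_refl))
      as [[p [[<- | []] [_ hp]]] [q [[<- | []] [_ hq]]]].
    exact (hq hp).
Qed.

(** Two of the three vertices fall into the same class, and the side through them misses the other
    class. The bound 3 simply counts all points. *)
Lemma triangle : exists (L : list line) (P : list point),
  NoDup P /\
  (forall l, In l L -> line_has_at_least P l 2) /\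
  (forall p, In p P -> shares_line_with_at_most L P p 3) /\
  ~ decomposable_two_covers L P.
Proof.
  assert (nx : 1 <> 0 \/ 0 <> 0) by lra.
  assert (ny : 0 <> 0 \/ 1 <> 0) by lra.
  assert (nd : 1 <> 0 \/ 1 <> 0) by lra.
  set (lx := Line 1 0 0 nx); set (ly := Line 0 1 0 ny); set (ld := Line 1 1 1 nd).
  set (o := (0, 0) : point); set (ex := (1, 0) : point); set (ey := (0, 1) : point).
  assert (d1 : o <> ex) by (intros e; injection e; lra).
  assert (d2 : o <> ey) by (intros e; injection e; lra).
  assert (d3 : ex <> ey) by (intros e; injection e; lra).
  assert (pair : forall p q : point, p <> q -> NoDup (p :: q :: nil)).
  { intros p q npq; repeat constructor; simpl; intuition. }
  exists (lx :: ly :: ld :: nil), (o :: ex :: ey :: nil); split; [| split; [| split]].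
  - repeat constructor; simpl; intuition.
  - assert (two : forall l p q, p <> q -> In p (o :: ex :: ey :: nil) ->
      In q (o :: ex :: ey :: nil) -> on_line l p -> on_line l q ->
      line_has_at_least (o :: ex :: ey :: nil) l 2).
    { intros l p q npq pP qP pl ql; exists (p :: q :: nil).
      split; [now apply pair |]; split; [apply le_n |].
      intros z [<- | [<- | []]]; now split. }
    intros l [<- | [<- | [<- | []]]].
    + apply (two lx o ey); unfold on_line; simpl; auto; lra.
    + apply (two ly o ex); unfold on_line; simpl; auto; lra.
    + apply (two ld ex ey); unfold on_line; simpl; auto; lra.
  - intros p _ s ns sub; apply (NoDup_incl_length ns (l' := o :: ex :: ey :: nil)).
    intros q hq; apply (sub q hq).
  - intros [P1 cover].
    assert (sides : forall l p q z, In l (lx :: ly :: ld :: nil) ->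
      (forall w, In w (o :: ex :: ey :: nil) -> w = p \/ w = q \/ w = z) ->
      ~ on_line l z -> ~ (P1 p <-> P1 q)).
    { intros l p q z hl all nz iff; destruct (cover l hl)
        as [[u [uP [ul pu]]] [v [vP [vl nv]]]].
      destruct (all u uP) as [-> | [-> | ->]]; destruct (all v vP) as [-> | [-> | ->]]; tauto. }
    assert (sx : ~ (P1 o <-> P1 ey)).
    { apply (sides lx o ey ex); unfold on_line; simpl; [auto | | lra].
      intuition. }
    assert (sy : ~ (P1 o <-> P1 ex)).
    { apply (sides ly o ex ey); unfold on_line; simpl; [auto | | lra].
      intuition. }
    assert (sd : ~ (P1 ex <-> P1 ey)).
    { apply (sides ld ex ey o); unfold on_line; simpl; [auto | | lra].
      intuition. }
    tauto.
Qed.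

Theorem theorem2p6 (r : nat) (hr : (0 < r)%nat) :
  let T := Nat.pow r (5 * (r * r)) in
  exists (L : list line) (P : list point),
    NoDup P /\
    (forall l, In l L -> line_has_at_least P l r) /\
    (forall p, In p P -> shares_line_with_at_most L P p T) /\
    ~ decomposable_two_covers L P.
Proof.
  (* The grid construction covers [r >= 3]; its numerical estimates fail for smaller [r], where a
     point on a line and a triangle serve. *)
  destruct r as [| [| [| r]]].
  - inversion hr.
  - intros T; replace T with 1%nat by (symmetry; apply Nat.pow_1_l).
    exact single_point.
  - intros T; destruct triangle as [L [P [nP [rich [share indec]]]]].
    exists L, P; split; [exact nP |]; split; [exact rich |]; split; [| exact indec].
    intros p hp s ns sub; apply (Nat.le_trans _ 3); [exact (share p hp s ns sub) |].
    apply (Nat.le_trans _ (2 ^ 2)); [repeat constructor |].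
    apply Nat.pow_le_mono_r; [discriminate | repeat constructor].
  - exact (Combinatorics.indecomposable_lines (r := S (S (S r))) eq_refl).
Qed.
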